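(* Let $\overline{\bm{p}}_{sa}\in\Delta_S$ with $\overline{\bm{p}}_{sa}>\bm{0}$, and let $\bm{b}\in\mathbb{R}^S_+$ and $\beta\in\mathbb{R}_+$ satisfy $\min\{\bm{b}\}\le\beta<\bm{b}^\top\overline{\bm{p}}_{sa}$. For the $\chi^2$-distance $\phi(t)=(t-1)^2$, the optimal value of the projection problem $$\mathfrak{P}(\overline{\bm{p}}_{sa};\bm{b},\beta)=\min\left\{\sum_{s'\in\mathcal{S}}\overline{p}_{sas'}\,\phi\!\left(\frac{p_{sas'}}{\overline{p}_{sas'}}\right) : \bm{b}^\top\bm{p}_{sa}\le\beta,\ \bm{p}_{sa}\in\Delta_S\right\}$$ can be computed exactly in time $\mathcal{O}(S\log S)$.
   Context: $\mathcal{S}=\{1,\dots,S\}$; $\Delta_S=\{\bm{p}\in\mathbb{R}^S_+ : \sum_{s'}p_{s'}=1\}$; the subscript $sa$ is a fixed index (state-action pair). $\min\{\bm{b}\}$ denotes the smallest component of $\bm{b}$. Running time counts elementary operations on real numbers (arithmetic operations and comparisons), each at unit cost. *)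

(* Defs.v *)
From HB Require Import structures.
From mathcomp Require Import all_boot all_order all_algebra.
From mathcomp Require Import all_classical all_reals all_analysis.

Set Implicit Arguments.
Unset Strict Implicit.
Unset Printing Implicit Defensive.

Import Order.TTheory GRing.Theory Num.Theory.
Import numFieldNormedType.Exports.

Local Open Scope classical_set_scope.
Local Open Scope ring_scope.

Section Projection.
Context {R : realType}.

Definition is_min (A : set R) (m : R) : Prop := A m /\ lbound A m.

Definition dotv S (u v : 'rV[R]_S) : R := \sum_(s < S) u 0 s * v 0 s.

Definition simplex S : set 'rV[R]_S :=
  [set p | (forall s, 0 <= p 0 s) /\ \sum_(s < S) p 0 s = 1].

Definition divergence (phi : R -> R) S (pbar p : 'rV[R]_S) : R :=
  \sum_(s < S) pbar 0 s * phi (p 0 s / pbar 0 s).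

Definition chi2 (t : R) : R := (t - 1) ^+ 2.

Definition feasible S (b : 'rV[R]_S) (beta : R) : set 'rV[R]_S :=
  [set p | dotv b p <= beta] `&` @simplex S.

Definition is_projection_value (phi : R -> R) S (pbar b : 'rV[R]_S) (beta v : R)
  : Prop := is_min (divergence phi pbar @` feasible b beta) v.

End Projection.

(* A structured real RAM.  Its memory consists of index registers holding
   naturals, real registers, and real arrays; registers and arrays are named by
   naturals, and array cells are addressed through index registers.  A program
   is a finite piece of syntax that depends neither on the input nor on its
   size, and the only real literals are naturals.  There is no rounding
   operation, no root extraction, and no multiplication of indices. *)

Inductive rop := RAdd | RSub | RMul | RDiv.

Inductive instr :=
| IConst of nat & nat           (* i := n *)
| IAdd of nat & nat & nat       (* i := j + k *)
| ISub of nat & nat & nat       (* i := j - k, truncated at 0 *)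
| RConst of nat & nat           (* x := n%:R *)
| ROp of rop & nat & nat & nat  (* x := y op z *)
| RGet of nat & nat & nat       (* x := a[i] *)
| RSet of nat & nat & nat.      (* a[i] := x *)

Inductive test :=
| ILt of nat & nat              (* i < j, on index registers *)
| RLe of nat & nat.             (* x <= y, on real registers *)

Inductive cmd :=
| Skip
| Instr of instr
| Seq of cmd & cmd
| If of test & cmd & cmd
| While of test & cmd.

Record state (R : realType) := State {
  idx : nat -> nat;
  reg : nat -> R;
  arr : nat -> nat -> R }.

Definition upd (A : Type) (f : nat -> A) (k : nat) (a : A) : nat -> A :=
  fun n => if n == k then a else f n.

Section Semantics.
Context {R : realType}.
Implicit Types st : state R.

Definition set_idx st i n :=
  State (upd (idx st) i n) (reg st) (arr st).
Definition set_reg st x r :=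
  State (idx st) (upd (reg st) x r) (arr st).
Definition set_cell st a k r :=
  State (idx st) (reg st) (upd (arr st) a (upd (arr st a) k r)).

Definition eval_rop (o : rop) (y z : R) : option R :=
  match o with
  | RAdd => Some (y + z)
  | RSub => Some (y - z)
  | RMul => Some (y * z)
  | RDiv => if z == 0 then None else Some (y / z)
  end.

Definition eval_instr (c : instr) st : option (state R) :=
  match c with
  | IConst i n => Some (set_idx st i n)
  | IAdd i j k => Some (set_idx st i (idx st j + idx st k)%N)
  | ISub i j k => Some (set_idx st i (idx st j - idx st k)%N)
  | RConst x n => Some (set_reg st x n%:R)
  | ROp o x y z => omap (set_reg st x) (eval_rop o (reg st y) (reg st z))
  | RGet x a i => Some (set_reg st x (arr st a (idx st i)))
  | RSet a i x => Some (set_cell st a (idx st i) (reg st x))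
  end.

Definition eval_test (c : test) st : bool :=
  match c with
  | ILt i j => (idx st i < idx st j)%N
  | RLe x y => reg st x <= reg st y
  end.

(* [exec c st st' t]: started in [st], [c] halts in [st'] after [t] steps.
   Every executed instruction and every evaluated test costs one step, so [t]
   bounds the number of arithmetic operations and comparisons on reals, and it
   also charges index arithmetic, loop control and memory accesses.  A run that
   diverges or divides by zero has no derivation. *)
Inductive exec : cmd -> state R -> state R -> nat -> Prop :=
| exec_skip st : exec Skip st st 0
| exec_instr i st st' :
    eval_instr i st = Some st' -> exec (Instr i) st st' 1
| exec_seq c1 c2 st1 st2 st3 t1 t2 :
    exec c1 st1 st2 t1 -> exec c2 st2 st3 t2 ->
    exec (Seq c1 c2) st1 st3 (t1 + t2)%N
| exec_if_true e c1 c2 st st' t :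
    eval_test e st -> exec c1 st st' t -> exec (If e c1 c2) st st' t.+1
| exec_if_false e c1 c2 st st' t :
    ~~ eval_test e st -> exec c2 st st' t -> exec (If e c1 c2) st st' t.+1
| exec_while_false e c st :
    ~~ eval_test e st -> exec (While e c) st st 1
| exec_while_true e c st1 st2 st3 t1 t2 :
    eval_test e st1 -> exec c st1 st2 t1 -> exec (While e c) st2 st3 t2 ->
    exec (While e c) st1 st3 (t1 + t2).+1.

Definition cells S (v : 'rV[R]_S) (k : nat) : R :=
  oapp (fun s : 'I_S => v 0 s) 0 (insub k).

(* Input convention: the size is in index register 0, [beta] in real register 0,
   [pbar] in array 0 and [b] in array 1; all other memory is zero. *)
Definition input S (pbar b : 'rV[R]_S) (beta : R) : state R :=
  State (upd (fun=> 0%N) 0 S)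
        (upd (fun=> 0) 0 beta)
        (upd (upd (fun=> fun=> 0) 0 (cells pbar)) 1 (cells b)).

Definition output (st : state R) : R := reg st 0%N.

End Semantics.

(* Main.v *)
(** The optimal kernel is [p_s = pbar_s * max(0, theta - b_s) / N], where [theta]
    is a root of [sum_s pbar_s * max(0, theta - b_s) * (b_s - beta)] (so that
    [dotv b p = beta]) and [N] normalises the total mass.  Optimality follows from
    the tangent inequality of the square at [p], because [max(0, theta - b_s)]
    equals [theta - b_s] wherever [p] is positive and dominates it elsewhere.

    Once the [b_s] are sorted, the function above is affine between consecutive
    values and vanishes at the smallest one.  Let [n] be the first rank at which it
    is positive: it has a root between ranks [n-1] and [n] (beyond rank [n-1] if
    there is no such [n]), given by the first [n] terms only.  No monotonicity is
    needed, and ties or [beta = min b] are no special case.  Sorting by bottom-up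
    merges costs [O(S log S)] and the scan is linear.  To avoid permutations, the
    sorting invariant says that every sum [sum_s F (b_s, pbar_s)] is preserved. *)
Require Import Defs.
From mathcomp Require Import all_boot all_order all_algebra.
From mathcomp Require Import all_classical all_reals all_analysis.
From mathcomp Require Import ring lra zify.
Import Order.TTheory GRing.Theory Num.Theory.
Import numFieldNormedType.Exports.
Local Open Scope classical_set_scope.
Local Open Scope ring_scope.

(** * Optimality of the thresholded kernel *)

Section Optimality.
Context {R : realType} (S : nat) (pbar b : 'rV[R]_S) (beta theta : R).
Hypothesis pbar_simplex : simplex pbar.
Hypothesis pbar_gt0 : forall s, 0 < pbar 0 s.

Let P := \sum_(s < S | b 0 s <= theta) pbar 0 s.
Let B := \sum_(s < S | b 0 s <= theta) pbar 0 s * b 0 s.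
Let C := \sum_(s < S | b 0 s <= theta) pbar 0 s * b 0 s * b 0 s.
Let N := theta * P - B.

(** With the active set [b_s <= theta] frozen, the sum of [pbar_s * (x - b_s) * (b_s - beta)] is
    affine in [x], namely [x * (B - beta * P) - (C - beta * B)]. It has positive slope and vanishes
    at [theta]. *)
Hypothesis slope_gt0 : 0 < B - beta * P.
Hypothesis theta_root : theta * (B - beta * P) = C - beta * B.

(** [N] is a sum of nonnegative terms. Were it zero, every active [b_s] would equal [theta]; the
    given [s] then forces [theta <= beta], so the slope would be at most 0. *)
Lemma active_mass_gt0 : (exists s, b 0 s <= beta) -> 0 < N.
Proof.
move=> [s0 bs0].
have NE : N = \sum_(s < S | b 0 s <= theta) pbar 0 s * (theta - b 0 s).
  rewrite /N /P /B mulr_sumr -sumrB; apply: eq_bigr => s _; ring.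
have N_ge0 : forall s, b 0 s <= theta -> 0 <= pbar 0 s * (theta - b 0 s).
  by move=> s bs; rewrite mulr_ge0 ?subr_ge0 // ltW.
rewrite lt_neqAle {2}NE sumr_ge0 ?andbT; last by move=> s; exact: N_ge0.
apply/eqP => /esym; rewrite NE => /eqP.
rewrite psumr_eq0; last by move=> s; exact: N_ge0.
move=> /allP N0.
have bE s : b 0 s <= theta -> b 0 s = theta.
  move=> bs; have := N0 s (mem_index_enum _).
  by rewrite bs /= mulf_eq0 gt_eqF //= subr_eq0 => /eqP.
have theta_le : theta <= beta.
  case: (leP theta (b 0 s0)) => [h|/ltW/bE h]; first exact: le_trans h bs0.
  by rewrite -h.
move: slope_gt0; rewrite ltNge => /negP; apply.
rewrite /B /P mulr_sumr -sumrB sumr_le0 // => s /bE ->.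
by rewrite mulrC -mulrBl pmulr_lle0 // subr_le0.
Qed.

(** The divergence of [p] is the [pbar]-second moment of the ratio [r], minus 1, whence the closed
    form. In the expansion of the divergence at [p], the linear term is at least
    [2 * (beta - dotv b q) / N], which is nonnegative for feasible [q]. *)
Lemma projection_valueE : 0 < N ->
  is_projection_value chi2 pbar b beta
    ((theta * (theta * P - B - B) + C) / (N * N) - 1).
Proof.
move=> N_gt0; have N_neq0 : N != 0 by rewrite gt_eqF.
case: pbar_simplex => _ pbar1.
pose r s := if b 0 s <= theta then (theta - b 0 s) / N else 0.
pose p : 'rV[R]_S := \row_s (pbar 0 s * r s).
have pE s : p 0 s = pbar 0 s * r s by rewrite mxE.
have r_ge0 s : 0 <= r s.
  by rewrite /r; case: ifP => // bs; rewrite divr_ge0 ?(ltW N_gt0) // subr_ge0.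
have p1 : \sum_(s < S) p 0 s = 1.
  rewrite -(divff N_neq0).
  rewrite {1}/N /P /B mulr_sumr -sumrB mulr_suml [RHS]big_mkcond /=.
  by apply: eq_bigr => s _; rewrite pE /r; case: ifP => _; ring.
have bp : dotv b p = beta.
  transitivity ((theta * B - C) / N).
    rewrite /dotv /C /B mulr_sumr -sumrB mulr_suml [RHS]big_mkcond /=.
    by apply: eq_bigr => s _; rewrite pE /r; case: ifP => _; ring.
  apply: (mulIf N_neq0); rewrite divfK // /N; move: theta_root; lra.
have prE : \sum_(s < S) p 0 s * r s = (theta * (theta * P - B - B) + C) / (N * N).
  have -> : theta * (theta * P - B - B) + C =
      theta * theta * P - (2 * theta) * B + C by ring.
  rewrite /P /C /B !mulr_sumr -sumrB -big_split /= mulr_suml [RHS]big_mkcond /=.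
  apply: eq_bigr => s _; rewrite pE /r; case: ifP => _; last by ring.
  by field.
(* Exact Taylor expansion at [p], quadratic remainder included. *)
have ratioE q s : pbar 0 s * chi2 (q / pbar 0 s) =
    pbar 0 s * chi2 (r s) + 2 * (r s - 1) * (q - p 0 s)
    + (q - p 0 s) ^+ 2 / pbar 0 s.
  rewrite pE /chi2; field; exact: lt0r_neq0.
have pval : divergence chi2 pbar p = \sum_(s < S) p 0 s * r s - 1.
  rewrite /divergence.
  transitivity (\sum_(s < S) (p 0 s * r s - 2 * p 0 s + pbar 0 s)).
    apply: eq_bigr => s _; rewrite ratioE pE /chi2; ring.
  by rewrite big_split sumrB -mulr_sumr p1 pbar1 /=; ring.
split.
- exists p; last by rewrite pval prE.
  split; first by rewrite /= bp.
  by split=> // s; rewrite pE mulr_ge0 // ltW.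
move=> _ [q [qb [q_ge0 q1]] <-]; rewrite /= in qb.
rewrite -prE -pval.
have tangent : divergence chi2 pbar p + 2 * ((beta - dotv b q) / N) <=
    divergence chi2 pbar q.
  have -> : beta - dotv b q = \sum_(s < S) (theta - b 0 s) * (q 0 s - p 0 s).
    have z : \sum_(s < S) theta * (q 0 s - p 0 s) = 0.
      by rewrite -mulr_sumr sumrB q1 p1 subrr mulr0.
    rewrite -bp /dotv -sumrB -[LHS]addr0 -[X in _ + X]z -big_split /=.
    by apply: eq_bigr => s _; ring.
  (* The part [- 2 * (q - p)] of the linear term is kept apart: it sums to 0, both kernels having
     mass 1. *)
  have -> : divergence chi2 pbar q = \sum_(s < S)
     (pbar 0 s * chi2 (p 0 s / pbar 0 s) + 2 * r s * (q 0 s - p 0 s)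
      + (q 0 s - p 0 s) ^+ 2 / pbar 0 s - 2 * q 0 s + 2 * p 0 s).
    apply: eq_bigr => s _; rewrite (ratioE (q 0 s)) (ratioE (p 0 s)); ring.
  rewrite big_split sumrB -!mulr_sumr q1 p1 /= addrNK mulr_suml mulr_sumr.
  rewrite -big_split; apply: ler_sum => s _; rewrite -addrA lerD2l.
  rewrite -[X in X <= _]addr0 lerD //; last by rewrite divr_ge0 ?sqr_ge0 // ltW.
  rewrite -[2 * r s * _]mulrA ler_pM2l // -mulrA [_ / N]mulrC mulrA.
  (* Equality on the active set; elsewhere [r] and [p] vanish and [(theta - b_s) * q_s <= 0]. *)
  rewrite /r pE /r; case: ifP => [_|/negbT]; first by [].
  rewrite -ltNge => bs; rewrite mulr0 subr0 mul0r -mulrA mulr_le0_ge0 //.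
    by rewrite subr_le0 ltW.
  by rewrite mulr_ge0 // invr_ge0 ltW.
apply: le_trans tangent; rewrite lerDl mulr_ge0 // divr_ge0 ?(ltW N_gt0) //.
by rewrite subr_ge0.
Qed.

End Optimality.

(** * Timed weakest preconditions *)

Section WeakestPrecondition.
Context {R : realType}.
Implicit Types (st : state R) (Q : nat -> state R -> Prop).

Definition halts (c : cmd) st Q : Prop :=
  exists st' t, exec c st st' t /\ Q t st'.

(** Straight-line code and branches reduce by computation, carrying the step count; a loop stays
    opaque until an invariant is supplied. *)
Fixpoint wp (c : cmd) Q st : Prop :=
  match c with
  | Skip => Q 0%N st
  | Instr i => if eval_instr i st is Some st' then Q 1%N st' else False
  | Seq c1 c2 =>
      wp c1 (fun t1 st1 => wp c2 (fun t2 st2 => Q (t1 + t2)%N st2) st1) st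
  | If e c1 c2 =>
      if eval_test e st then wp c1 (fun t => Q t.+1) st
      else wp c2 (fun t => Q t.+1) st
  | While _ _ => halts c st Q
  end.

Lemma wp_halts c Q st : wp c Q st -> halts c st Q.
Proof.
elim: c Q st => [|i|c1 IH1 c2 IH2|e c1 IH1 c2 IH2|e c _] Q st //=.
- by move=> h; exists st, 0%N; split=> //; constructor.
- case E: (eval_instr i st) => [st'|//] h.
  by exists st', 1%N; split=> //; constructor.
- move=> /IH1 [st1 [t1 [e1 /IH2 [st2 [t2 [e2 h]]]]]].
  by exists st2, (t1 + t2)%N; split=> //; apply: exec_seq e1 e2.
- case: ifP => he.
    move=> /IH1 [st1 [t1 [e1 h]]]; exists st1, t1.+1; split=> //.
    exact: exec_if_true.
  move=> /IH2 [st1 [t1 [e1 h]]]; exists st1, t1.+1; split=> //.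
  by apply: exec_if_false => //; rewrite he.
Qed.

(** Induction on the variant [m]. The strict bound [t < k] leaves one step for the test of each
    round; the final [1] is the failing test. *)
Lemma halts_while e c (I : state R -> Prop) (m : state R -> nat) k st :
  (forall st, I st -> eval_test e st ->
     wp c (fun t st' => [/\ I st', (m st' < m st)%N & (t < k)%N]) st) ->
  I st ->
  halts (While e c) st
    (fun t st' => [/\ I st', ~~ eval_test e st' & (t <= m st * k + 1)%N]).
Proof.
move=> body; have [n] := ubnP (m st); elim: n st => // n IH st mn Ist.
case: (boolP (eval_test e st)) => he; last first.
  exists st, 1%N; split; first exact: exec_while_false.
  by split=> //; rewrite addn1.
have [st1 [t1 [e1 [I1 m1 t1k]]]] := wp_halts _ _ _ (body _ Ist he).
have [|st2 [t2 [e2 [I2 he2 t2k]]]] := IH st1 _ I1.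
  exact: leq_trans m1 (ltnSE mn).
exists st2, (t1 + t2).+1; split; first exact: exec_while_true he e1 e2.
split=> //; have := leq_mul m1 (leqnn k); rewrite mulSn; lia.
Qed.

Lemma halts_weaken c st Q Q' :
  (forall t st', Q t st' -> Q' t st') -> halts c st Q -> halts c st Q'.
Proof. by move=> QQ' [st' [t [e /QQ' h]]]; exists st', t. Qed.

Lemma wp_weaken c st Q Q' :
  (forall t st', Q t st' -> Q' t st') -> wp c Q st -> wp c Q' st.
Proof.
elim: c Q Q' st => [|i|c1 IH1 c2 IH2|e c1 IH1 c2 IH2|e c _] Q Q' st QQ' /=.
- exact: QQ'.
- by case: eval_instr => // st'; exact: QQ'.
- by apply: IH1 => t1 st1; apply: IH2 => t2 st2; exact: QQ'.
- by case: ifP => _; [apply: IH1 | apply: IH2] => t1 st1; exact: QQ'.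
- exact: halts_weaken.
Qed.

(* Composition with an intermediate assertion; unfolding [wp] instead would
   duplicate the postcondition at each branch of [c1]. *)
Lemma wp_seq c1 c2 M Q st :
  wp c1 M st -> (forall t1 st1, M t1 st1 ->
    wp c2 (fun t2 st2 => Q (t1 + t2)%N st2) st1) -> wp (Seq c1 c2) Q st.
Proof. by move=> h1 h2; apply: wp_weaken h1. Qed.

Lemma wp_while (I : state R -> Prop) (m : state R -> nat) k e c st Q :
  I st ->
  (forall st1, I st1 -> eval_test e st1 ->
     wp c (fun t st2 => [/\ I st2, (m st2 < m st1)%N & (t < k)%N]) st1) ->
  (forall t st', I st' -> ~~ eval_test e st' -> (t <= m st * k + 1)%N ->
     Q t st') ->
  wp (While e c) Q st.
Proof.
move=> Ist body post; apply: halts_weaken (halts_while e c I m k st body Ist).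
by move=> t st' [*]; exact: post.
Qed.

End WeakestPrecondition.

(** * Merge sort *)

Definition prog_seq (cs : seq cmd) : cmd := foldr Seq Skip cs.
Definition instrs (l : seq instr) : cmd := prog_seq [seq Instr i | i <- l].

(* Index registers: 0 = size, 1 = run width, 2 = output position, 3 and 5 =
   positions in the two runs, 4 and 6 = ends of the two runs, 7 = 1, 8 = source
   cell.  Keys are in array 1 with weights in array 0; arrays 3 and 2 are the
   scratch copies.  Doing [ISub x 0 x] twice truncates register x to the size. *)
Definition next_runs : cmd := If (ILt 2 6) Skip (instrs [::
  IConst 3 0; IAdd 3 3 2; IAdd 4 2 1; ISub 4 0 4; ISub 4 0 4;
  IConst 5 0; IAdd 5 5 4; IAdd 6 5 1; ISub 6 0 6; ISub 6 0 6]).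

Definition take_left : cmd := instrs [:: IConst 8 0; IAdd 8 8 3; IAdd 3 3 7].
Definition take_right : cmd := instrs [:: IConst 8 0; IAdd 8 8 5; IAdd 5 5 7].

Definition choose_run : cmd :=
  If (ILt 3 4)
    (If (ILt 5 6)
       (prog_seq [:: Instr (RGet 1 1 3); Instr (RGet 2 1 5);
          If (RLe 1 2) take_left take_right])
       take_left)
    take_right.

Definition move_cell : cmd :=
  instrs [:: RGet 1 1 8; RGet 2 0 8; RSet 3 2 1; RSet 2 2 2; IAdd 2 2 7].

Definition merge_step : cmd := Seq next_runs (Seq choose_run move_cell).

Section Merge.
Context {R : realType}.
Implicit Types (a b d : nat -> R).

Definition runs_sorted w n a := forall q i j, (q * w <= i)%N -> (i <= j)%N ->
  (j < q * w + w)%N -> (j < n)%N -> a i <= a j.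

(** The unread parts of the current two runs are [[i, mid)] and [[j, hi)]; their pair starts at
    [lo]. The equations for [lo], [mid], [hi] are guarded by [k < hi], so that the all-zero state
    before the first pair qualifies. A finished pair only records that the pass is over or that the
    next pair is aligned. *)
Record merge_inv S w a b da db k i mid j hi : Prop := MergeInv {
  merge_run : exists lo q, [/\ (lo <= i)%N,
    k = hi -> k = S \/ exists q', k = (q' * (w + w))%N,
    (k < hi)%N ->
      [/\ lo = (q * (w + w))%N, mid = minn (lo + w) S & hi = minn (lo + (w + w)) S] &
    forall m m', (lo <= m < k)%N -> (i <= m' < mid)%N || (j <= m' < hi)%N ->
      da m <= a m'];
  merge_range : [/\ (i <= mid)%N, (mid <= j)%N, (j <= hi)%N, (hi <= S)%N &
    (k + mid)%N = (i + j)%N];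
  merge_sorted : runs_sorted (w + w) k da;
  merge_sum : forall F : R -> R -> R,
    \sum_(0 <= m < k) F (da m) (db m) =
    \sum_(0 <= m < i) F (a m) (b m) + \sum_(mid <= m < j) F (a m) (b m) }.

Lemma merge_inv0 S w a b da db : merge_inv S w a b da db 0 0 0 0 0.
Proof.
split=> //; last by move=> F; rewrite !big_nil addr0.
by exists 0%N, 0%N; split=> // _; right; exists 0%N.
Qed.

(** Counting cells forces [i = mid] and [j = hi = k]: both runs are used up, and the two ranges read
    join into [[0, k)]. *)
Lemma merge_inv_next S w a b da db k i mid j hi :
  (0 < w)%N -> (k < S)%N -> ~~ (k < hi)%N ->
  merge_inv S w a b da db k i mid j hi ->
  let mid' := minn (k + w) S in let hi' := minn (mid' + w) S in
  merge_inv S w a b da db k k mid' mid' hi' /\ (k < hi')%N.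
Proof.
move=> w0 kS khi [[lo [q [loi hik _ _]]] [im mj jh hS km] ds sm] mid' hi'.
have ek : k = hi by lia.
have [kq|[q' kq]] := hik ek; first by lia.
split; last by rewrite /hi' /mid'; lia.
split.
- exists k, q'; split=> //; [|by rewrite /hi' /mid'; split; lia|by lia].
  by rewrite /hi' /mid'; lia.
- by rewrite /hi' /mid'; split; lia.
- by [].
- move=> F; rewrite sm [\sum_(mid' <= m < mid') _]big_geq // addr0.
  have -> : i = mid by lia.
  by rewrite -big_cat_nat //=; have -> : j = k by lia.
Qed.

(** The moved key is least among the unread ones and bounds those already written for this pair. *)
Lemma merge_inv_move S w a b da db k i mid j hi s i' j' :
  runs_sorted w S a -> (k < hi)%N ->
  merge_inv S w a b da db k i mid j hi ->
  [\/ [/\ (i < mid)%N, s = i, i' = i.+1, j' = j & (j < hi)%N -> a i <= a j] |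
      [/\ (j < hi)%N, s = j, i' = i, j' = j.+1 & (i < mid)%N -> a j <= a i]] ->
  merge_inv S w a b (upd da k (a s)) (upd db k (b s)) k.+1 i' mid j' hi.
Proof.
move=> asort khi [[lo [q [loi hik /(_ khi) [loE midE hiE] dle]]]
  [im mj jh hS km] ds sm] step.
(* The runs of pair [q] are the blocks [2q] and [2q + 1] of width [w]. *)
have eL m m' : (i <= m <= m')%N -> (m' < mid)%N -> a m <= a m'.
  by move=> h1 h2; apply: (asort (q + q)%N); lia.
have eR m m' : (j <= m <= m')%N -> (m' < hi)%N -> a m <= a m'.
  by move=> h1 h2; apply: (asort (q + q).+1%N); lia.
have sle m' : (i' <= m' < mid)%N || (j' <= m' < hi)%N -> a s <= a m'.
  case: step => [[h1 -> -> -> h2]|[h1 -> -> -> h2]] h.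
    case: (ltnP m' mid) => hm; first by apply: eL; lia.
    by apply: (le_trans (h2 _)); [lia|apply: eR; lia].
  case: (ltnP m' mid) => hm; last by apply: eR; lia.
  by apply: (le_trans (h2 _)); [lia|apply: eL; lia].
have dles m : (lo <= m < k)%N -> da m <= a s.
  by move=> h; apply: dle => //; case: step => [[h1 -> _ _ _]|[h1 -> _ _ _]]; lia.
have ii : (i <= i')%N by case: step => [[]|[]]; lia.
have jj : (j <= j')%N by case: step => [[]|[]]; lia.
split.
- exists lo, q; split; [lia| | by []| ].
    move=> kh; have [hlo|] := leqP (lo + (w + w)) S; [right|left; lia].
    by exists q.+1; rewrite mulSn; lia.
  move=> m m' h h'; rewrite /upd; case: eqP => [_|mk]; first exact: sle.
  by apply: dle; lia.
- by case: step => [[]|[]] *; split; lia.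
- move=> q' m m' h1 h2 h3 h4; rewrite /upd.
  case: (m =P k) => mk; case: (m' =P k) => m'k //; [lia| |by apply: (ds q'); lia].
  (* Cell [k] lies in pair [q], so the block of width [w + w] containing it is [q]; otherwise the
     two blocks would be disjoint. *)
  suff: q' = q by move=> qq; apply: dles; move: h1; rewrite qq -loE; lia.
  apply/eqP; rewrite eqn_leq; apply/andP; split; rewrite leqNgt; apply/negP => hq.
    by have := leq_mul hq (leqnn (w + w)); rewrite mulSn; lia.
  by have := leq_mul hq (leqnn (w + w)); rewrite mulSn; lia.
- move=> F; rewrite big_nat_recr //= /upd eqxx.
  rewrite (eq_big_nat _ _ (F2 := fun m => F (da m) (db m))); last first.
    by move=> m /andP[_ mk]; rewrite !ifN ?neq_ltn ?mk.
  rewrite sm; case: step => [[h1 -> -> -> _]|[h1 -> -> -> _]].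
    by rewrite [X in _ = X + _]big_nat_recr //=; ring.
  by rewrite [X in _ = _ + X]big_nat_recr //= addrA.
Qed.

End Merge.

(** * Sorting passes and their cost *)

Definition merge_pass : cmd :=
  Seq (instrs [:: IConst 2 0; IConst 3 0; IConst 4 0; IConst 5 0; IConst 6 0])
      (While (ILt 2 0) merge_step).

Definition copy_step : cmd :=
  instrs [:: RGet 1 3 2; RSet 1 2 1; RGet 1 2 2; RSet 0 2 1; IAdd 2 2 7].

Definition copy_pass : cmd :=
  Seq (Instr (IConst 2 0)) (While (ILt 2 0) copy_step).

Definition sort_step : cmd :=
  Seq merge_pass (Seq copy_pass (Instr (IAdd 1 1 1))).

Definition sort_prog : cmd :=
  Seq (instrs [:: IConst 7 1; IConst 1 1]) (While (ILt 1 0) sort_step).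

Section Sort.
Context {R : realType} (S : nat) (beta : R).
Implicit Types (st : state R) (a b : nat -> R).

Definition frame w st :=
  [/\ idx st 0 = S, idx st 1 = w, idx st 7 = 1%N & reg st 0 = beta].

Definition pass_inv w a b st :=
  [/\ frame w st, arr st 1 = a, arr st 0 = b &
    merge_inv S w a b (arr st 3) (arr st 2)
      (idx st 2) (idx st 3) (idx st 4) (idx st 5) (idx st 6)].

Lemma wp_next_runs w a b st : (0 < w)%N ->
  pass_inv w a b st -> (idx st 2 < S)%N ->
  wp next_runs (fun t st' => [/\ pass_inv w a b st', idx st' 2 = idx st 2,
    (idx st' 2 < idx st' 6)%N & (t <= 11)%N]) st.
Proof.
case: st => ix rg ar w0 [[/= i0 i1 i7 r0] a1 a0 inv] kS; rewrite /=.
case: ifP => kh /=; first by [].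
rewrite /upd /= i0 i1.
have [inv' kh'] := merge_inv_next _ _ _ _ _ _ _ _ _ _ _ w0 kS (negbT kh) inv.
have minE x : (S - (S - x))%N = minn x S by lia.
by rewrite !minE !add0n; split=> //; split.
Qed.

Lemma wp_choose_run w a b st : runs_sorted w S a ->
  pass_inv w a b st -> (idx st 2 < idx st 6)%N ->
  wp choose_run (fun t st' =>
    [/\ frame w st', arr st' = arr st,
      merge_inv S w a b (upd (arr st 3) (idx st 2) (a (idx st' 8)))
        (upd (arr st 2) (idx st 2) (b (idx st' 8))) (idx st 2).+1
        (idx st' 3) (idx st' 4) (idx st' 5) (idx st' 6),
      idx st' 2 = idx st 2 & (t <= 8)%N]) st.
Proof.
case: st => ix rg ar asort [[/= i0 i1 i7 r0] a1 a0 inv] kh.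
have [im mj jh hS km] := merge_range _ _ _ _ _ _ _ _ _ _ _ inv.
have step := merge_inv_move _ _ _ _ _ _ _ _ _ _ _ _ _ _ asort kh inv.
rewrite /=; case: ifP => ltl /=; last first.
  rewrite /upd /= i7 !add0n; split=> //; apply: step; right; split=> //; lia.
case: ifP => ltr /=; last first.
  by rewrite /upd /= i7 !add0n; split=> //; apply: step; left; split=> //; lia.
rewrite /upd /= a1; case: leP => le_lr /=.
  by rewrite /upd /= i7 !add0n; split=> //; apply: step; left; split=> //; lia.
rewrite /upd /= i7 !add0n; split=> //; apply: step; right; split=> //; try lia.
by move=> _; exact: ltW.
Qed.

Lemma wp_merge_step w a b st : (0 < w)%N -> runs_sorted w S a ->
  pass_inv w a b st -> (idx st 2 < S)%N ->
  wp merge_step (fun t st' => [/\ pass_inv w a b st',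
    idx st' 2 = (idx st 2).+1 & (t <= 24)%N]) st.
Proof.
move=> w0 asort inv kS; rewrite /merge_step.
apply: wp_seq (wp_next_runs _ _ _ _ w0 inv kS) _.
move=> t1 st1 [inv1 <- kh t1_le] {inv kS st}.
apply: wp_seq (wp_choose_run _ _ _ _ asort inv1 kh) _.
case: inv1 => _ a1 a0 _.
move=> t2 [ix rg ar] [[/= i0 i1 i7 r0] ea /= inv2 k2 t2_le].
rewrite /upd /=; split; [split=> //; rewrite /=| |].
- by rewrite ea.
- by rewrite ea.
- by rewrite k2 i7 addn1 !ea a1 a0.
- by rewrite k2 i7 addn1.
- lia.
Qed.

Lemma wp_merge_pass w st : (0 < w)%N -> frame w st ->
  runs_sorted w S (arr st 1) ->
  wp merge_pass (fun t st' => [/\ frame w st',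
    runs_sorted (w + w) S (arr st' 3),
    (forall F : R -> R -> R,
      \sum_(0 <= m < S) F (arr st' 3 m) (arr st' 2 m) =
      \sum_(0 <= m < S) F (arr st 1 m) (arr st 0 m)) &
    (t <= S * 25 + 6)%N]) st.
Proof.
case: st => ix rg ar w0 [/= i0 i1 i7 r0] asort.
apply: (wp_while (pass_inv w (ar 1%N) (ar 0%N)) (fun st => S - idx st 2)%N 25).
- by split=> //; exact: merge_inv0.
- move=> st inv lt_kS.
  have kS : (idx st 2 < S)%N by case: inv lt_kS => [[/= -> _ _ _]].
  apply: wp_weaken (wp_merge_step _ _ _ _ w0 asort inv kS).
  by move=> t st' [inv' k' t_le]; split=> //; lia.
- move=> t st' [fr a1 a0 inv] /=; have [e0 _ _ _] := fr; rewrite e0 => kS t_le.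
  case: inv => _ [im mj jh hS km] ds sm.
  have [kE jE iE] : [/\ idx st' 2 = S, idx st' 5 = S & idx st' 3 = idx st' 4].
    by split; lia.
  rewrite kE in ds sm; split=> //.
    move=> F; rewrite sm iE jE -big_cat_nat //=; lia.
  by move: t_le; rewrite /= subn0; lia.
Qed.

Lemma wp_copy_pass w st : frame w st ->
  wp copy_pass (fun t st' => [/\ frame w st',
    (forall m, (m < S)%N -> arr st' 1 m = arr st 3 m /\ arr st' 0 m = arr st 2 m)
    & (t <= S * 6 + 2)%N]) st.
Proof.
case: st => ix rg ar [/= i0 i1 i7 r0].
apply: (wp_while (fun st => [/\ frame w st, arr st 3 = ar 3%N, arr st 2 = ar 2%N,
   (idx st 2 <= S)%N & forall m, (m < idx st 2)%N ->
     arr st 1 m = ar 3%N m /\ arr st 0 m = ar 2%N m])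
   (fun st => S - idx st 2)%N 6).
- by split.
- move=> [ix' rg' ar'] [[/= j0 j1 j7 s0] e3 e2 kS eq_k]; rewrite /upd /= j0 => lt_k.
  rewrite j7 addn1; split; [|by lia|by []].
  split=> //= m; rewrite ltnS leq_eqVlt e3 e2 /upd.
  by case: eqP => [-> //|_]; exact: eq_k.
- move=> t st' [fr e3 e2 kS eq_k] /=; have [e0 _ _ _] := fr.
  rewrite e0 => nk t_le; split=> //; last by move: t_le; rewrite /= subn0; lia.
  by move=> m mS; apply: eq_k; lia.
Qed.

Definition sorted_upto w a b st :=
  [/\ frame w st, runs_sorted w S (arr st 1) &
    forall F : R -> R -> R, \sum_(0 <= m < S) F (arr st 1 m) (arr st 0 m) =
      \sum_(0 <= m < S) F (a m) (b m)].

Lemma wp_sort_step w a b st : (0 < w)%N -> sorted_upto w a b st ->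
  wp sort_step (fun t st' => sorted_upto (w + w) a b st' /\ (t <= S * 31 + 9)%N) st.
Proof.
move=> w0 [fr asort sum_eq]; apply: wp_seq (wp_merge_pass _ _ w0 fr asort) _.
move=> t1 st1 [fr1 sort1 sum1 t1_le].
apply: wp_seq (wp_copy_pass _ _ fr1) _.
move=> t2 [ix rg ar] [[/= i0 i1 i7 r0] eq_c t2_le].
split; last by lia.
split; first by split=> //=; rewrite /upd /= i1.
  move=> q i j h1 h2 h3 h4 /=.
  by rewrite (eq_c _ h4).1 (eq_c i _).1; [apply: (sort1 q)|lia].
move=> F; rewrite -sum_eq -sum1; apply: eq_big_nat => m /andP[_ mS] /=.
by have [-> ->] := eq_c _ mS.
Qed.

(** The width [2 ^ p] doubles at each pass, so [up_log 2 S - p] is a variant; at exit a single block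
    covers the array. *)
Lemma wp_sort_prog st : idx st 0 = S -> reg st 0 = beta ->
  wp sort_prog (fun t st' =>
    (exists2 w, (S <= w)%N & sorted_upto w (arr st 1) (arr st 0) st') /\
    (t <= up_log 2 S * (S * 31 + 10) + 3)%N) st.
Proof.
case: st => ix rg ar /= i0 r0.
apply: (wp_while (fun st => exists2 p, (p <= up_log 2 S)%N &
    sorted_upto (2 ^ p) (ar 1%N) (ar 0%N) st)
  (fun st => up_log 2 S - up_log 2 (idx st 1))%N (S * 31 + 10)).
- exists 0%N => //; split=> // q i j h1 h2 h3 _.
  by have -> : i = j by lia.
- move=> st [p p_le inv] lt_wS; have [[e0 e1 _ _] _ _] := inv.
  have pS : (2 ^ p < S)%N by move: lt_wS; rewrite /= e0 e1.
  have p0 : (0 < 2 ^ p)%N by rewrite expn_gt0.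
  apply: wp_weaken (wp_sort_step _ _ _ _ p0 inv).
  move=> t st' [inv' t_le].
  have p_lt : (p < up_log 2 S)%N.
    rewrite ltnNge; apply/negP => h; move: pS; rewrite ltnNge => /negP; apply.
    by apply: leq_trans (@up_logP 2 S isT) _; rewrite leq_exp2l.
  have pE : (2 ^ p + 2 ^ p = 2 ^ p.+1)%N by rewrite expnS mul2n addnn.
  rewrite pE in inv'; split; [by exists p.+1| |lia].
  have [[_ -> _ _] _ _] := inv'.
  by rewrite e1 !up_expnK //; lia.
- move=> t st' [p p_le inv] /=; have [[e0 e1 _ _] _ _] := inv.
  rewrite e0 e1 -leqNgt => Sp t_le; split; first by exists (2 ^ p)%N.
  by move: t_le; rewrite /= /upd /= up_log1; lia.
Qed.

End Sort.

(** * Scan for the threshold *)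

(* Index registers: 1 = end of the scan, 2 = number [n] of cells scanned.  Real
   registers: 3, 4, 5 = sums of the weights times the keys to the powers 0, 1, 2
   over the first [n] cells, 6 = 0, 7 and 8 = slope and offset of the affine
   function whose root is sought. *)
Definition scan_probe : cmd :=
  instrs [:: RGet 1 1 2; RGet 2 0 2; ROp RMul 9 1 7; ROp RSub 9 9 8].

Definition scan_add : cmd := instrs [::
  ROp RAdd 3 3 2; ROp RMul 2 2 1; ROp RAdd 4 4 2; ROp RMul 2 2 1;
  ROp RAdd 5 5 2; ROp RMul 10 0 3; ROp RSub 7 4 10; ROp RMul 10 0 4;
  ROp RSub 8 5 10; IAdd 2 2 7].

(** The loop is left by lowering its bound, index register 1, to the current rank. *)
Definition scan_step : cmd :=
  Seq scan_probe (If (RLe 9 6) scan_add (instrs [:: IConst 8 0; IAdd 1 8 2])).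

Definition scan_prog : cmd :=
  Seq (instrs [:: IConst 2 0; IConst 8 0; IAdd 1 8 0; RConst 3 0; RConst 4 0;
         RConst 5 0; RConst 6 0; RConst 7 0; RConst 8 0])
      (While (ILt 2 1) scan_step).

Definition numerator_prog : cmd := instrs [::
  ROp RMul 10 9 3; ROp RSub 10 10 4; ROp RMul 1 10 10;
  ROp RSub 10 10 4; ROp RMul 10 9 10; ROp RAdd 10 10 5].

Definition finish_prog : cmd :=
  Seq (Instr (ROp RDiv 9 8 7)) (Seq numerator_prog
    (Seq (Instr (ROp RDiv 10 10 1)) (instrs [:: RConst 1 1; ROp RSub 0 10 1]))).

Section Scan.
Context {R : realType} (S : nat) (beta : R) (a b : nat -> R).

(** Here [a] holds the sorted keys and [b] the weights. [x * E n - K n] is the sum of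
    [b m * (x - a m) * (a m - beta)] over [m < n]. *)
Let P n := \sum_(0 <= m < n) b m.
Let B n := \sum_(0 <= m < n) b m * a m.
Let C n := \sum_(0 <= m < n) b m * a m * a m.
Let E n := B n - beta * P n.
Let K n := C n - beta * B n.

Definition threshold_index n :=
  [/\ (n <= S)%N, (n < S)%N -> 0 < a n * E n - K n &
      (0 < n)%N -> a n.-1 * E n - K n <= 0].

(** The new term has the factor [x - a n], zero at [x = a n]: consecutive affine pieces agree at
    their breakpoint. *)
Lemma gapS n : a n * E n.+1 - K n.+1 = a n * E n - K n.
Proof. by rewrite /E /K /P /B /C !big_nat_recr //=; ring. Qed.

(** The affine function [x * E n - K n] is nonpositive at [a n.-1] and positive at [a n], so its
    slope is positive and its root lies in between. If [n = S], the slope is positive by assumption.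
    The strict sign at [a n] leaves exactly the first [n] ranks active. *)
Lemma threshold_root n : (0 < S)%N ->
  (forall i j, (i <= j)%N -> (j < S)%N -> a i <= a j) ->
  0 < E S -> threshold_index n ->
  [/\ 0 < E n, forall m, (m < n)%N -> a m <= K n / E n &
      forall m, (n <= m < S)%N -> K n / E n < a m].
Proof.
move=> S0 asort ES [nS gt_n le_n].
(* With no terms the function is 0, hence not positive at rank 0. *)
have n0 : (0 < n)%N.
  rewrite lt0n; apply/eqP => n0; have := gt_n; rewrite n0 => /(_ S0).
  by rewrite /E /K /P /B /C !big_nil !mulr0 !subrr mulr0 subrr ltxx.
have /le_n {}le_n := n0.
have En : 0 < E n.
  have [nltS|nS'] := ltnP n S; last by have -> : n = S by lia.
  have : 0 < (a n - a n.-1) * E n by have := gt_n nltS; move: le_n; lra.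
  rewrite [0 < E n]ltNge => gap_gt0; apply/negP => En.
  by move: gap_gt0; rewrite ltNge mulr_ge0_le0 // subr_ge0 asort //; lia.
split=> // m.
  move=> mn; rewrite ler_pdivlMr //; rewrite subr_le0 in le_n.
  by apply: le_trans le_n; rewrite ler_pM2r // asort //; lia.
move=> /andP[nm mS]; rewrite ltr_pdivrMr //.
have := gt_n (leq_ltn_trans nm mS); rewrite subr_gt0 => /lt_le_trans; apply.
by rewrite ler_pM2r // asort.
Qed.

Definition scanned n (st : state R) :=
  [/\ [/\ idx st 0 = S, idx st 2 = n, idx st 7 = 1%N & reg st 0 = beta],
      arr st 1 = a, arr st 0 = b &
      [/\ reg st 3 = P n, reg st 4 = B n, reg st 5 = C n, reg st 7 = E n
        & reg st 8 = K n]].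

Lemma wp_scan_step n st : scanned n st -> reg st 6 = 0 ->
  wp scan_step (fun t st' => [/\ reg st' 6 = 0, (t < 16)%N &
    [/\ a n * E n - K n <= 0, scanned n.+1 st' & idx st' 1 = idx st 1] \/
    [/\ 0 < a n * E n - K n, scanned n st' & idx st' 1 = n]]) st.
Proof.
move=> sc r6.
have : wp scan_probe (fun t st1 => [/\ t = 4%N, scanned n st1,
    idx st1 1 = idx st 1, reg st1 6 = 0 &
    [/\ reg st1 1 = a n, reg st1 2 = b n & reg st1 9 = a n * E n - K n]]) st.
  case: st sc r6 => ix rg ar [[/= e0 e2 e7 s0] ea eb [r3 r4 r5 r7 r8]] r6.
  by rewrite /upd /= e2 ea eb r7 r8.
move=> /wp_seq; apply => t1 [ix rg ar].
move=> [-> [[/= e0 e2 e7 s0] ea eb [r3 r4 r5 r7 r8]] <- {}r6 [r1 r2 r9]].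
rewrite /= r6 r9; case: leP => gap.
  rewrite /upd /=; split=> //; left; split=> //.
  rewrite /scanned /= r1 r2 r3 r4 r5 e2 e7 s0 addn1.
  by split=> //; rewrite /E /K /P /B /C !big_nat_recr.
rewrite /upd /=; split=> //; right; split=> //.
Qed.

Lemma wp_scan_prog st :
  [/\ idx st 0 = S, idx st 7 = 1%N & reg st 0 = beta] ->
  arr st 1 = a -> arr st 0 = b ->
  wp scan_prog (fun t st' => (exists2 n, threshold_index n & scanned n st') /\
    (t <= S * 16 + 10)%N) st.
Proof.
case: st => ix rg ar [/= i0 i7 r0] a1 a0.
(* The loop bound is still [S], or it was lowered to [n] after a positive value there. *)
apply: (wp_while (fun st => exists n, [/\ scanned n st, reg st 6 = 0,
    (n <= idx st 1 <= S)%N,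
    idx st 1 = S \/ n = idx st 1 /\ 0 < a n * E n - K n &
    (0 < n)%N -> a n.-1 * E n - K n <= 0]) (fun st => idx st 1 - idx st 2)%N 16).
- exists 0%N; rewrite /scanned /upd /= i0.
  rewrite /E /K /P /B /C !big_nil !mulr0 !subrr.
  by split=> //; left.
- move=> st [n [sc r6 nL Lor le_n]] nltL.
  have [[_ e2 _ _] _ _ _] := sc; rewrite /= e2 in nltL.
  apply: wp_weaken (wp_scan_step _ _ sc r6) => t st' [r6' t_lt].
  case=> -[gap sc' L']; have [[_ e2' _ _] _ _ _] := sc'.
    split=> //; last by rewrite L' e2 e2'; lia.
    exists n.+1; rewrite gapS L'; split=> //; first lia.
    by case: Lor => [|[]]; [left|lia].
  split=> //; last by rewrite L' e2 e2'; lia.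
  by exists n; rewrite L'; split=> //; [lia|right].
- move=> t st' [n [sc r6 nL Lor le_n]] /=; have [[e0 e2 e7 s0] _ _ _] := sc.
  rewrite e2 => nltL t_le; split; last first.
    by move: t_le; rewrite /upd /= i0; lia.
  exists n => //; split=> //; first lia.
  by case: Lor => [|[]] //; lia.
Qed.

Lemma wp_div x y z (Q : nat -> state R -> Prop) st : reg st z != 0 ->
  Q 1%N (set_reg st x (reg st y / reg st z)) -> wp (Instr (ROp RDiv x y z)) Q st.
Proof. by move=> z0; rewrite /wp /eval_instr /eval_rop (negbTE z0). Qed.

Lemma wp_finish_prog n theta st : scanned n st -> theta = K n / E n ->
  E n != 0 -> theta * P n - B n != 0 ->
  wp finish_prog (fun t st' => output st' =
    (theta * (theta * P n - B n - B n) + C n) /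
      ((theta * P n - B n) * (theta * P n - B n)) - 1 /\ t = 10%N) st.
Proof.
move=> [_ _ _ [r3 r4 r5 r7 r8]] thetaE E0 N0.
apply: (wp_seq _ _ (fun t st1 => [/\ t = 1%N, reg st1 9 = theta, reg st1 3 = P n,
    reg st1 4 = B n & reg st1 5 = C n])).
  by apply: wp_div; rewrite r7 // r8 -thetaE.
move=> _ st1 [-> {r3 r4 r5 r7 r8} r9 r3 r4 r5].
apply: (wp_seq _ _ (fun t st1 => [/\ t = 6%N,
    reg st1 10 = theta * (theta * P n - B n - B n) + C n &
    reg st1 1 = (theta * P n - B n) * (theta * P n - B n)])).
  by case: st1 r9 r3 r4 r5 => ix rg ar /= r9 r3 r4 r5; rewrite /upd /= r9 r3 r4 r5.
move=> _ st2 [-> r10 r1].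
apply: (wp_seq _ _ (fun t st2 => t = 1%N /\ reg st2 10 =
    (theta * (theta * P n - B n - B n) + C n) /
      ((theta * P n - B n) * (theta * P n - B n)))).
  by apply: wp_div; rewrite r1 ?mulf_neq0 // r10.
by move=> _ [ix' rg' ar'] [-> /= {}r10]; rewrite /output /upd /= r10.
Qed.

End Scan.

(** * Running time and correctness *)

(** Rounding up adds at most 1 to the binary logarithm, which is itself at least 1; hence the factor
    2. *)
Lemma up_log2_le_ln {R : realType} n : (1 < n)%N ->
  (up_log 2 n)%:R <= 2 / ln 2 * ln n%:R :> R.
Proof.
move=> n1; have ln2 : 0 < ln 2 :> R by rewrite ln_gt0 // ltr1n.
have lnX m : ln (2 ^ m)%:R = m%:R * ln 2 :> R.
  by rewrite natrX lnXn // mulr_natl.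
have le_n : (up_log 2 n).-1%:R * ln 2 <= ln n%:R :> R.
  rewrite -lnX ler_ln ?posrE ?ltr0n ?expn_gt0 ?ler_nat //; last lia.
  exact: ltnW (up_log_gtn _ _).
have le_2 : ln 2 <= ln n%:R :> R.
  by rewrite ler_ln ?posrE ?ltr0n ?ler_nat //; lia.
have -> : up_log 2 n = ((up_log 2 n).-1 + 1)%N.
  by have := up_log_gt0 2 n; rewrite n1 /=; lia.
by rewrite natrD mulrAC ler_pdivlMr //; lra.
Qed.

Definition sorting_time (c d : nat) n := (up_log 2 n * (n * c + c) + n * d + d)%N.

Lemma sorting_time_bigO {R : realType} (c d : nat) :
  (fun n => (sorting_time c d n)%:R : R) =O_\oo (fun n => n%:R * ln n%:R : R).
Proof.
(* For [n > 1] each additive [c] or [d] is absorbed by doubling; the successor keeps the constant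
   positive. *)
apply/eqO_exP; exists ((2 * c + 2 * d).+1%:R * (2 / ln 2)).
  by rewrite mulr_gt0 // ?ltr0n // divr_gt0 // ln_gt0 // ltr1n.
near=> n.
have n1 : (1 < n)%N by near: n; exact: nbhs_infty_ge.
have u1 : (0 < up_log 2 n)%N by rewrite up_log_gt0.
have ln_n0 : 0 <= ln n%:R :> R by rewrite ln_ge0 // ler1n; lia.
rewrite !ger0_norm ?mulr_ge0 //.
apply: (@le_trans _ _ (((2 * c + 2 * d).+1 * n * up_log 2 n)%:R)).
  rewrite ler_nat /sorting_time.
  have h1 : (c <= n * c)%N by apply: leq_pmull; lia.
  have h2 : (d <= n * d)%N by apply: leq_pmull; lia.
  have h3 := leq_pmulr (n * d) u1.
  have := leq_mul (leqnn (up_log 2 n)) (leq_add (leqnn (n * c)) h1).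
  by rewrite !mulSn; nia.
have -> : (2 * c + 2 * d).+1%:R * (2 / ln 2) * (n%:R * ln n%:R) =
    ((2 * c + 2 * d).+1 * n)%:R * (2 / ln 2 * ln n%:R) :> R.
  by rewrite [in RHS]natrM; ring.
by rewrite natrM ler_wpM2l // up_log2_le_ln.
Unshelve. all: by end_near. Qed.

(** * Assembly of sorting, scan and evaluation *)

Definition projection_prog : cmd := Seq sort_prog (Seq scan_prog finish_prog).

Section Correctness.
Context {R : realType} (S : nat) (pbar b : 'rV[R]_S) (beta bmin : R).

Lemma sum_cells (F : R -> R -> R) :
  \sum_(0 <= m < S) F (cells b m) (cells pbar m) =
  \sum_(s < S) F (b 0 s) (pbar 0 s).
Proof.
by rewrite big_mkord; apply: eq_bigr => s _; rewrite /cells valK.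
Qed.

Hypothesis pbar_simplex : simplex pbar.
Hypothesis pbar_gt0 : forall s, 0 < pbar 0 s.
Hypothesis bmin_min : is_min (range (b 0)) bmin.
Hypothesis bmin_le : bmin <= beta.
Hypothesis beta_lt : beta < dotv b pbar.

Lemma wp_projection_prog :
  wp projection_prog (fun t st => is_projection_value chi2 pbar b beta (output st) /\
    (t <= sorting_time 31 23 S)%N) (input pbar b beta).
Proof.
have [[s0 _ bs0] _] := bmin_min.
have S0 : (0 < S)%N by exact: leq_ltn_trans (ltn_ord s0).
rewrite /projection_prog.
apply: wp_seq (wp_sort_prog S beta (input pbar b beta) erefl erefl) _.
move=> t1 st1 [[w Sw [[e0 _ e7 r0] asort sumE]] t1_le].
set a := arr st1 1 in asort sumE; set p := arr st1 0 in sumE.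
have {}sumE (F : R -> R -> R) :
    \sum_(0 <= m < S) F (a m) (p m) = \sum_(s < S) F (b 0 s) (pbar 0 s).
  by rewrite sumE; exact: sum_cells.
apply: wp_seq (wp_scan_prog S beta a p st1 _ erefl erefl) _ => //.
move=> t2 st2 [[n n_thr sc] t2_le].
(* Block 0 is the whole array, as [S <= w]. *)
have a_sorted i j : (i <= j)%N -> (j < S)%N -> a i <= a j.
  by move=> ij jS; apply: (asort 0%N) => //; lia.
have total_gt0 : 0 < \sum_(0 <= m < S) p m * a m - beta * \sum_(0 <= m < S) p m.
  rewrite (sumE (fun x y => y * x)) (sumE (fun _ y => y)) pbar_simplex.2 mulr1.
  rewrite subr_gt0 (lt_le_trans beta_lt) // le_eqVlt; apply/orP; left.
  by apply/eqP; apply: eq_bigr => s _; rewrite mulrC.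
have [E_gt0 le_theta theta_lt] :=
  threshold_root S beta a p n S0 a_sorted total_gt0 n_thr.
set theta := _ / _ in le_theta theta_lt.
(* Preservation of sums is applied to [F] cut off at [theta]; in sorted order the cut-off keeps
   exactly the ranks below [n]. *)
have prefixE (F : R -> R -> R) : \sum_(0 <= m < n) F (a m) (p m) =
    \sum_(s < S | b 0 s <= theta) F (b 0 s) (pbar 0 s).
  have [nS _ _] := n_thr.
  rewrite [RHS]big_mkcond -(sumE (fun x y => if x <= theta then F x y else 0)).
  rewrite [RHS](@big_cat_nat _ _ _ n) //= [X in _ + X]big_nat_cond.
  rewrite [X in _ + X]big1 ?addr0.
    by apply: eq_big_nat => m /andP[_ mn]; rewrite le_theta.
  by move=> m; rewrite andbT => /theta_lt; rewrite ltNge => /negbTE ->.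
have theta_root : theta * (\sum_(0 <= m < n) p m * a m - beta * \sum_(0 <= m < n) p m)
   = \sum_(0 <= m < n) p m * a m * a m - beta * \sum_(0 <= m < n) p m * a m.
  by rewrite /theta divfK // gt_eqF.
have PE := prefixE (fun _ y => y).
have BE := prefixE (fun x y => y * x).
have CE := prefixE (fun x y => y * x * x).
have N_gt0 := active_mass_gt0 S pbar b beta theta pbar_gt0.
rewrite /= in PE BE CE.
rewrite -PE -BE in N_gt0.
have {}N_gt0 : 0 < theta * \sum_(0 <= m < n) p m - \sum_(0 <= m < n) p m * a m.
  (* A minimiser of [b] lies below [beta]. *)
  by apply: N_gt0 => //; exists s0; rewrite bs0.
have val := projection_valueE S pbar b beta theta pbar_simplex pbar_gt0.
rewrite -PE -BE -CE in val.
apply: wp_weaken (wp_finish_prog S beta a p n theta _ sc erefl _ _);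
  rewrite ?gt_eqF //.
move=> t3 st3 [-> ->]; split; first exact: val.
(* 31 is the cost per cell of a sorting pass; 23 adds the constants 3, 10 and 10 of the three stages
   and exceeds the 16 steps per scanned cell. *)
by move: t1_le t2_le; rewrite /sorting_time; nia.
Qed.

End Correctness.

Theorem theorem5 (R : realType) :
  exists (prog : cmd) (T : nat -> nat),
    ((fun S : nat => (T S)%:R : R) =O_\oo (fun S : nat => S%:R * ln S%:R : R))
    /\
    forall (S : nat) (pbar b : 'rV[R]_S) (beta bmin : R),
      simplex pbar -> (forall s, 0 < pbar 0 s) ->
      (forall s, 0 <= b 0 s) -> 0 <= beta ->
      is_min (range (b 0)) bmin -> bmin <= beta -> beta < dotv b pbar ->
      exists (st : state R) (t : nat),
        [/\ exec prog (input pbar b beta) st t,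
            (t <= T S)%N
          & is_projection_value chi2 pbar b beta (output st)].
Proof.
exists projection_prog, (sorting_time 31 23); split.
  exact: sorting_time_bigO.
move=> S pbar b beta bmin h1 h2 _ _ h3 h4 h5.
have [st [t [run [val t_le]]]] :=
  wp_halts _ _ _ (wp_projection_prog _ _ _ _ _ h1 h2 h3 h4 h5).
by exists st, t.
Qed.
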